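(* Let $r\ge 3$ be an integer, let $n\ge 1$, and let $1>p_1\ge p_2\ge\cdots\ge p_n>0$ be real numbers, with the convention $p_i=0$ for $i>n$. Write $\mathbf p=(p_1,\ldots,p_n)$. Suppose that $p_{r+1}<\frac{r-1}{r}$. If $\mathcal A\subseteq 2^{[n]}$ is $r$-wise intersecting, then $$\mu_{\mathbf p}(\mathcal A)\le p_1.$$ Moreover, equality holds if and only if $\mathcal A=\mathcal S_i$ for some $i\in[n]$ with $p_i=p_1$.
   Context: $[n]=\{1,\ldots,n\}$ and $2^{[n]}$ is the set of all subsets of $[n]$. For $\mathcal A\subseteq 2^{[n]}$ the $\mathbf p$-biased measure is $\mu_{\mathbf p}(\mathcal A)=\sum_{A\in\mathcal A}\prod_{i\in A}p_i\prod_{j\in[n]\setminus A}(1-p_j)$. A family $\mathcal A\subseteq 2^{[n]}$ is $r$-wise intersecting if $A_1\cap\cdots\cap A_r\neq\emptyset$ for all (not necessarily distinct) $A_1,\ldots,A_r\in\mathcal A$. The star centred at $i\in[n]$ is $\mathcal S_i=\{A\subseteq[n]: i\in A\}$. *)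

(* Defs.v *)
From mathcomp Require Import all_boot all_order all_algebra reals.

Set Implicit Arguments.
Unset Strict Implicit.
Unset Printing Implicit Defensive.

Import Order.TTheory GRing.Theory Num.Theory.

Local Open Scope ring_scope.

(* The ground set [n] = {1, ..., n} is 'I_n = {0, ..., n-1}: the element that
   is usually called i is the ordinal of value i - 1. *)

(* The vector p extended by 0 beyond its length.  Indices start at 0, so
   the usual p_k is [zext p k.-1]: p_1 is [zext p 0] and p_(r+1) is
   [zext p r]. *)
Definition zext (R : realType) (n : nat) (p : 'I_n -> R) (k : nat) : R :=
  if insub k is Some i then p i else 0.

Definition biased_measure (R : realType) (n : nat) (p : 'I_n -> R)
    (F : {set {set 'I_n}}) : R :=
  \sum_(A in F) ((\prod_(i in A) p i) * (\prod_(j in ~: A) (1 - p j))).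

Definition wise_intersecting (r n : nat) (F : {set {set 'I_n}}) : Prop :=
  forall A : 'I_r -> {set 'I_n},
    (forall k, A k \in F) -> \bigcap_(k < r) A k != set0.

Definition star (n : nat) (i : 'I_n) : {set {set 'I_n}} :=
  [set A : {set 'I_n} | i \in A].

(* Main.v *)
Require Import Defs.
From mathcomp Require Import all_boot all_order all_algebra reals.
From mathcomp Require Import ring lra.
From mathcomp Require Import exp convex hoelder interval_inference.

Set Implicit Arguments.
Unset Strict Implicit.
Unset Printing Implicit Defensive.

Import Order.TTheory GRing.Theory Num.Theory.

Local Open Scope ring_scope.

(** Put q = (r - 1) / r and P = max(p_1, q), where p_1 is the largest entry of
    the vector p.  Replacing F by its up-closure keeps it r-wise intersecting
    and strictly increases the measure unless F was already an up-set, so let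
    F be an up-set.

    Comparison of measures.  If t >= 1 and p_i <= p'_i ^ t for all i, then
    mu_p(F) <= mu_p'(F) ^ t ([expose_powR]); this is an induction on the
    coordinates whose step is the convexity of x ^ t.  Choose t with
    P ^ t = p_1, so t = 1 when p_1 >= q, and let p'_i be P on the first r
    coordinates and q on the others.  It remains to show that
    mu_p'(F) <= P and that equality forces F to be a star.

    A random colouring.  Put m = 1 / (1 - P), a real number with m >= r.
    Colour the ground set with r colours: uniformly and independently outside
    the set X of the first r coordinates, and on X so that a given colouring
    with j colours has a probability proportional to
    m (m - 1) ... (m - j + 1) / (r (r - 1) ... (r - j + 1)).  If m is an
    integer, the partition of X into colour classes is the one given by a
    uniform colouring of X with m colours.  The identities behind the
    computation of its marginals are polynomial in m, so they persist for real
    m, and the weights remain positive because #|X| <= r <= m.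
    The complement of the class of a given colour equals A with probability at
    most (m / r) mu_p'({A}) ([sum_colourings_class]).  The r complements have
    empty intersection, so one of them is outside F; taking expectations gives
    1 <= m mu_p'(~: F), which is mu_p'(F) <= 1 - 1 / m = P ([core_bound]).

    Equality.  All colourings have positive weight, so in the case of equality
    exactly one class of every colouring has its complement outside F.  As
    r >= 3, this says that the sets with complement outside F form an
    ultrafilter, which is principal because the ground set is finite, and F is
    a star ([exactly_one_star]). *)

(** * Convexity of real powers *)

(** The increments of a convex function over an interval of fixed length [d]
    increase with its left end: [b] and [a + d] are mirror images of each other
    between [a] and [b + d]. *)
Lemma powR_increment (R : realType) (t a b d : R) :
  1 <= t -> 0 <= a -> a <= b -> 0 <= d ->
  powR b t + powR (a + d) t <= powR a t + powR (b + d) t.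
Proof.
move=> t1 a0 ab d0.
have [D0|D0] := eqVneq (b + d - a) 0.
  have -> : b = a by lra.
  by have -> : d = 0 by lra.
have Dp : 0 < b + d - a by rewrite lt_def D0 /=; lra.
(* the barycentric coordinate of b between a and b + d, weighting a *)
pose l := d / (b + d - a).
have l0 : 0 <= l by apply: divr_ge0 => //; exact: ltW.
have l1 : l <= 1 by rewrite ler_pdivrMr // mul1r; lra.
have cvx u v (k : R) : 0 <= u -> 0 <= v -> 0 <= k -> k <= 1 ->
    powR (k * u + (1 - k) * v) t <= k * powR u t + (1 - k) * powR v t.
  move=> u0 v0 k0 k1.
  have := @convex_powR R t t1 (Itv01 k0 k1) u v.
  rewrite /= !convRE /=.
  by apply; apply: classical_sets.mem_set; rewrite /= in_itv /= ?u0 ?v0.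
have bE : l * a + (1 - l) * (b + d) = b by rewrite /l; field.
have adE : (1 - l) * a + l * (b + d) = a + d by rewrite /l; field.
have bd0 : 0 <= b + d by lra.
have H1 := cvx _ _ _ a0 bd0 l0 l1.
have H2 := cvx _ _ (1 - l) a0 bd0 ltac:(lra) ltac:(lra).
move: H1 H2; rewrite bE subKr adE; nra.
Qed.

(** The one-coordinate case of the comparison of measures, [x] and [y] being the
    measures of the two sections.  For [v = u ^ t] it is [powR_increment]
    with the points [u * x <= u * y] and the increment [x - u * x]. *)
Lemma powR_mix (R : realType) (t u v x y : R) :
  1 <= t -> 0 <= u <= 1 -> v <= powR u t -> 0 <= x -> x <= y ->
  v * powR y t + (1 - v) * powR x t <= powR (u * y + (1 - u) * x) t.
Proof.
move=> t1 /andP[u0 u1] vu x0 xy.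
have y0 : 0 <= y := le_trans x0 xy.
have xyt : powR x t <= powR y t.
  by apply: ge0_ler_powR; rewrite ?nnegrE //; lra.
have ux0 : 0 <= u * x by apply: mulr_ge0.
have uxy : u * x <= u * y by apply: ler_wpM2l.
have d0 : 0 <= x - u * x by nra.
have := powR_increment t1 ux0 uxy d0.
rewrite addrCA subrr addr0 !powRM // => H.
have -> : u * y + (1 - u) * x = u * y + (x - u * x) by ring.
apply: le_trans (_ : powR u t * powR y t + (1 - powR u t) * powR x t <= _).
  by nra.
lra.
Qed.

(** * Biased measures, one coordinate at a time *)

Section Measure.

Variables (R : realType) (n : nat).
Implicit Types (p : 'I_n -> R) (F G : {set {set 'I_n}}) (A B C D : {set 'I_n}).

(** The conditional measure of [F] when the coordinates outside [s] have been
    revealed and [C] is the set of those that are present.  Inductions on [s]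
    replace the manipulation of sums over all subsets. *)
Fixpoint expose p F (s : seq 'I_n) C : R :=
  if s is a :: s' then
    p a * expose p F s' (a |: C) + (1 - p a) * expose p F s' C
  else (C \in F)%:R.

Lemma expose_sum p F s C : uniq s -> C \subset ~: [set i in s] ->
  expose p F s C =
  \sum_(A : {set 'I_n} | A :\: [set i in s] == C)
     (\prod_(i <- s) (if i \in A then p i else 1 - p i)) * (A \in F)%:R.
Proof.
elim: s C => [|a s IH] C /=.
  move=> _ _; rewrite (big_pred1 C) ?big_nil ?mul1r // => A.
  by rewrite set_nil setD0.
case/andP=> as_ us sC.
have aC : a \notin C.
  by apply/negP => /(subsetP sC); rewrite !inE eqxx.
have sC' : C \subset ~: [set i in s].
  apply: subset_trans sC _; apply/subsetP=> i.
  by rewrite !inE negb_or => /andP[].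
rewrite (bigID (fun A : {set 'I_n} => a \in A)) /=.
congr (_ + _).
  rewrite IH //; last first.
    by apply/subsetP=> i /setU1P[->|/(subsetP sC')//]; rewrite !inE.
  rewrite mulr_sumr; apply: eq_big => [A|A].
    apply/eqP/andP => [H|[/eqP H aA]].
      have aA : a \in A.
        by have := setU11 a C; rewrite -H inE => /andP[].
      split=> //; apply/eqP/setP=> i; move/setP/(_ i): H.
      rewrite !inE; have [->|] := eqVneq i a; first by rewrite (negPf aC).
      by [].
    apply/setP=> i; move/setP/(_ i): H.
    by rewrite !inE; have [->|] := eqVneq i a; rewrite ?aA ?as_.
  move=> /eqP H; have aA : a \in A.
    by have := setU11 a C; rewrite -H inE => /andP[].
  by rewrite big_cons aA mulrA.
rewrite IH // mulr_sumr; apply: eq_big => [A|A].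
  apply/eqP/andP => [H|[/eqP H aA]].
    have aA : a \notin A.
      by apply: contra aC => aA; rewrite -H !inE as_ aA.
    split=> //; apply/eqP/setP=> i; move/setP/(_ i): H.
    rewrite !inE; have [->|] := eqVneq i a.
      by rewrite (negPf aC) (negPf aA).
    by [].
  apply/setP=> i; move/setP/(_ i): H.
  rewrite !inE; have [->|] := eqVneq i a; last by [].
  by rewrite ?(negPf aA) ?(negPf aC) ?andbF.
move=> /eqP H; have aA : a \notin A.
  by apply: contra aC => aA; rewrite -H !inE as_ aA.
by rewrite big_cons (negPf aA) mulrA.
Qed.

Lemma weightE p A :
  (\prod_(i in A) p i) * (\prod_(j in ~: A) (1 - p j)) =
  \prod_i (if i \in A then p i else 1 - p i).
Proof.
rewrite [RHS](bigID (fun i => i \in A)) /=; congr (_ * _).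
  by apply: eq_bigr => i ->.
by apply: eq_big => [i|i]; rewrite inE // => /negPf ->.
Qed.

Lemma biased_measureE p F : biased_measure p F = expose p F (enum 'I_n) set0.
Proof.
rewrite expose_sum ?enum_uniq ?sub0set // /biased_measure big_mkcond /=.
apply: eq_big => [A|A _].
  by apply/esym/eqP/setP=> i; rewrite !inE mem_enum.
rewrite big_enum /= -weightE.
by case: (A \in F); rewrite ?mulr1 ?mulr0.
Qed.

Lemma expose_setT p s C : expose p setT s C = 1.
Proof.
by elim: s C => [|a s IH] C /=; rewrite ?inE // !IH; ring.
Qed.

Lemma expose_star p s C i : uniq s ->
  expose p (star i) s C =
  if i \in C then 1 else if i \in s then p i else 0.
Proof.
elim: s C => [|a s IH] C /=; first by rewrite inE; case: (i \in C).
case/andP=> as_ us; rewrite !IH // !inE.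
have [->|ia] := eqVneq i a; rewrite /= ?(negPf as_).
  by case: (a \in C); ring.
by case: (i \in C); ring.
Qed.

Lemma measure_star p i : biased_measure p (star i) = p i.
Proof. by rewrite biased_measureE expose_star ?enum_uniq // inE mem_enum. Qed.

(** * Comparison of measures on up-sets *)

Definition upset F :=
  forall A B : {set 'I_n}, A \in F -> A \subset B -> B \in F.

Lemma expose_ge0 p F s C : (forall i, 0 <= p i <= 1) -> 0 <= expose p F s C.
Proof.
move=> p01; elim: s C => [|a s IH] C /=; first exact: ler0n.
have /andP[? ?] := p01 a.
by apply: addr_ge0; apply: mulr_ge0; rewrite ?subr_ge0.
Qed.

Lemma expose_mono p F s C D : (forall i, 0 <= p i <= 1) -> upset F ->
  C \subset D -> expose p F s C <= expose p F s D.
Proof.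
move=> p01 upF; elim: s C D => [|a s IH] C D CD /=.
  by case CF: (C \in F); rewrite ?(upF _ _ CF CD) ?ler0n.
have /andP[? ?] := p01 a.
by apply: lerD; apply: ler_wpM2l; rewrite ?subr_ge0 // IH // setUS.
Qed.

(** The inequality has the shape of [powR_mix] at every coordinate, and [upset]
    orders the two sections as [powR_mix] requires.  With [t = 1] it says that
    the measure is monotone in [p]; with [p] and [p'] constant it says that
    log mu_p(F) / log p does not increase with p. *)
Lemma expose_powR p p' (t : R) F s C : 1 <= t ->
  (forall i, 0 <= p i <= 1) -> (forall i, 0 <= p' i <= 1) ->
  (forall i, p i <= powR (p' i) t) -> upset F ->
  expose p F s C <= powR (expose p' F s C) t.
Proof.
move=> t1 p01 p'01 pp' upF; elim: s C => [|a s IH] C /=.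
  case: (C \in F); first by rewrite powR1.
  exact: powR_ge0.
have /andP[pa0 pa1] := p01 a.
apply: le_trans (_ : p a * powR (expose p' F s (a |: C)) t +
   (1 - p a) * powR (expose p' F s C) t <= _).
  by apply: lerD; apply: ler_wpM2l; rewrite ?subr_ge0.
apply: powR_mix => //; first exact: expose_ge0.
by apply: expose_mono => //; exact: subsetUr.
Qed.

Lemma measureC p F : biased_measure p F = 1 - biased_measure p (~: F).
Proof.
have <- : biased_measure p setT = 1 by rewrite biased_measureE expose_setT.
rewrite /biased_measure [in RHS](big_setID F) /= setTI setTD.
by rewrite addrK.
Qed.

(** * Up-closures *)

Definition up_closure F := [set B : {set 'I_n} | [exists A in F, A \subset B]].

Lemma up_closureP F : upset (up_closure F).
Proof.
move=> A B; rewrite !inE => /exists_inP[D DF DA] AB.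
by apply/exists_inP; exists D => //; apply: subset_trans AB.
Qed.

Lemma sub_up_closure F : F \subset up_closure F.
Proof. by apply/subsetP=> A AF; rewrite inE; apply/exists_inP; exists A. Qed.

Lemma up_closure_wise r F :
  wise_intersecting r F -> wise_intersecting r (up_closure F).
Proof.
move=> hF A AF.
have ex k : exists B, (B \in F) && (B \subset A k).
  by have := AF k; rewrite inE => /exists_inP[B BF BA]; exists B; apply/andP.
have H k := andP (xchooseP (ex k)).
have /set0Pn[x /bigcapP xB] := hF _ (fun k => (H k).1).
apply/set0Pn; exists x; apply/bigcapP=> k _.
by apply: (subsetP (H k).2); apply: xB.
Qed.

Lemma weight_gt0 p A : (forall i, 0 < p i < 1) ->
  0 < (\prod_(i in A) p i) * (\prod_(j in ~: A) (1 - p j)).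
Proof.
move=> p01; rewrite weightE; apply: prodr_gt0 => i _.
by have /andP[? ?] := p01 i; case: ifP; rewrite ?subr_gt0.
Qed.

Lemma measure_sub p F G : (forall i, 0 < p i < 1) -> F \subset G ->
  biased_measure p F <= biased_measure p G ?= iff (F == G).
Proof.
move=> p01 FG; have GF : G :&: F = F by apply/setIidPr.
have E : biased_measure p G = biased_measure p F + biased_measure p (G :\: F).
  by rewrite /biased_measure (big_setID F) /= GF.
have ge0 : 0 <= biased_measure p (G :\: F).
  by apply: sumr_ge0 => A _; apply/ltW/weight_gt0.
split; first by rewrite E lerDl.
apply/eqP/eqP => [|-> //]; rewrite E => /eqP; rewrite -subr_eq0 opprD addNKr.
rewrite oppr_eq0 psumr_eq0; last by move=> A _; apply/ltW/weight_gt0.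
move/allP=> H; apply/eqP; rewrite eqEsubset FG /=; apply/subsetP=> A AG.
apply: contraT => AF; have := H A (mem_index_enum _).
by rewrite inE AG AF /= gt_eqF // weight_gt0.
Qed.

End Measure.

(** * Weighted colourings *)

Section Colourings.

Variables (R : realType) (I T : finType).
Implicit Types (x m : R) (X A : {set I}) (S Q : {set T}) (c : {ffun I -> T}).

(** The ratio of falling factorials x (x - 1) ... (x - j + 1) over
    s (s - 1) ... (s - j + 1).  It is the weight of a colouring with [s] colours
    of which [j] are used on [X]: for an integer [x], multiplying the number
    s (s - 1) ... (s - j + 1) of such colourings with given classes on [X] by
    this weight gives the number of colourings of [X] with [x] colours that have
    these classes. *)
Definition ffact_ratio x (s j : nat) : R :=
  \prod_(i < j) ((x - i%:R) / (s%:R - i%:R)).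

Lemma ffact_ratioS x s j :
  ffact_ratio x s j.+1 = ffact_ratio x s j * ((x - j%:R) / (s%:R - j%:R)).
Proof. by rewrite /ffact_ratio big_ord_recr. Qed.

Lemma ffact_ratioSl x s j :
  ffact_ratio x s.+1 j.+1 = x / s.+1%:R * ffact_ratio (x - 1) s j.
Proof.
rewrite /ffact_ratio big_ord_recl !subr0; congr (_ * _).
apply: eq_bigr => i _; rewrite /= /bump /= add1n.
rewrite -[s.+1]add1n -[i.+1]add1n !natrD.
by rewrite !opprD !addrA; congr (_ / _); ring.
Qed.

Lemma ffact_ratio_gt0 x s j : s%:R <= x -> (j <= s)%N -> 0 < ffact_ratio x s j.
Proof.
move=> sx js; apply: prodr_gt0 => i _.
have si : i%:R < s%:R :> R by rewrite ltr_nat (leq_trans _ js).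
by apply: divr_gt0; lra.
Qed.

Lemma ffact_ratio_leS x s j : s%:R <= x -> (j < s)%N ->
  ffact_ratio x s j <= ffact_ratio x s j.+1.
Proof.
move=> sx js; rewrite ffact_ratioS.
have sj : j%:R < s%:R :> R by rewrite ltr_nat.
rewrite ler_peMr ?(ltW (ffact_ratio_gt0 _ _)) //; first exact: ltnW.
by rewrite ler_pdivlMr; lra.
Qed.

(** Colour one more element of [X] when the colours of [Q] are in use: reusing
    one of them keeps the weight, and a new one multiplies it by
    (x - #|Q|) / (#|S| - #|Q|), so the total is
    #|Q| + (x - #|Q|) = x times the old weight.  If all colours of [S] are in
    use, only the first term #|S| <= x is left. *)
Lemma ffact_ratio_step x S Q : #|S|%:R <= x -> Q \subset S ->
  \sum_(l in S) ffact_ratio x #|S| #|l |: Q| <= ffact_ratio x #|S| #|Q| * x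
  /\ ((#|Q| < #|S|)%N ->
  \sum_(l in S) ffact_ratio x #|S| #|l |: Q| = ffact_ratio x #|S| #|Q| * x).
Proof.
move=> Sx QS; set s := #|S| in Sx *; set g := ffact_ratio x s.
have -> : \sum_(l in S) g #|l |: Q| =
          #|Q|%:R * g #|Q| + (s%:R - #|Q|%:R) * g #|Q|.+1.
  rewrite (big_setID Q) /= (setIidPr QS); congr (_ + _).
    rewrite (eq_bigr (fun=> g #|Q|)); last first.
      by move=> l lQ; rewrite (setUidPr _) // sub1set.
    by rewrite sumr_const mulr_natl.
  rewrite (eq_bigr (fun=> g #|Q|.+1)); last first.
    by move=> l /setDP[_ lQ]; rewrite cardsU1 lQ.
  rewrite sumr_const cardsD (setIidPr QS) -natrB ?subset_leq_card //.
  by rewrite mulr_natl.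
have E : (#|Q| < s)%N ->
    #|Q|%:R * g #|Q| + (s%:R - #|Q|%:R) * g #|Q|.+1 = g #|Q| * x.
  move=> Qs; rewrite /g ffact_ratioS.
  have : #|Q|%:R < s%:R :> R by rewrite ltr_nat.
  by move=> ?; field; lra.
split=> //; have := subset_leq_card QS.
rewrite leq_eqVlt => /orP[/eqP Qs|/E->//].
rewrite Qs subrr mul0r addr0 mulrC ler_wpM2l //.
by apply/ltW/ffact_ratio_gt0.
Qed.

(** The total weight of the colourings that extend [c0] from outside [s], with
    colours of [S] on [s].  Only colours in [S] count as used, so that
    fixing a whole class of another colour through [c0] does not affect the
    weight.  By [ffact_ratio_step] each element of [X] contributes a factor [x];
    equality needs a colour of [S] to be free whenever an element of [X] is
    coloured, which [#|X| <= #|S|] ensures. *)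
Lemma sum_colourings x X S (s : seq I) c0 : #|S|%:R <= x -> uniq s ->
  let total := \sum_(c : {ffun I -> T} |
      [forall i, if i \in s then c i \in S else c i == c0 i])
    ffact_ratio x #|S| #|c @: X :&: S| in
  let bound := ffact_ratio x #|S| #|c0 @: (X :\: [set i in s]) :&: S| *
    \prod_(i <- s) (if i \in X then x else #|S|%:R) in
  total <= bound /\ ((#|X| <= #|S|)%N -> total = bound).
Proof.
move=> Sx; elim: s c0 => [|a s IH] c0 /=.
  move=> _; rewrite (big_pred1 c0) ?big_nil ?mulr1 ?set_nil ?setD0 //.
  move=> c; apply/forallP/eqP => [H|-> i]; last exact: eqxx.
  by apply/ffunP=> i; apply/eqP/H.
case/andP=> as_ us.
set X' := X :\: [set i in a :: s].
pose Q := c0 @: X' :&: S.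
(* c0 after a has received the colour l *)
pose upd l : {ffun I -> T} := [ffun i => if i == a then l else c0 i].
have updE l : l \in S -> upd l @: (X :\: [set i in s]) :&: S =
    if a \in X then l |: Q else Q.
  move=> lS; have [aX|aX] := boolP (a \in X).
    have -> : X :\: [set i in s] = a |: X'.
      apply/setP=> i; rewrite !inE; have [->|//] := eqVneq i a.
      by rewrite as_ aX.
    rewrite imsetU1 ffunE eqxx setIUl (setIidPl _) ?sub1set //.
    congr (_ |: (_ :&: _)); apply: eq_in_imset => i.
    by rewrite !inE ffunE negb_or => /andP[/andP[/negPf->]].
  have -> : X :\: [set i in s] = X'.
    apply/setP=> i; rewrite !inE; have [->|//] := eqVneq i a.
    by rewrite (negPf aX) andbF.
  congr (_ :&: _); apply: eq_in_imset => i.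
  by rewrite !inE ffunE negb_or => /andP[/andP[/negPf->]].
rewrite (partition_big (fun c : {ffun I -> T} => c a) (mem S)) /=; last first.
  by move=> c /forallP/(_ a); rewrite inE eqxx.
have inner l : l \in S ->
  \sum_(c : {ffun I -> T} |
      [forall i, if i \in a :: s then c i \in S else c i == c0 i]
      && (c a == l)) ffact_ratio x #|S| #|c @: X :&: S| =
  \sum_(c : {ffun I -> T} |
      [forall i, if i \in s then c i \in S else c i == upd l i])
     ffact_ratio x #|S| #|c @: X :&: S|.
  move=> lS; apply: eq_bigl => c.
  apply/andP/forallP => [[/forallP H /eqP cal] i|H].
    have := H i; rewrite inE ffunE; have [->|//] := eqVneq i a.
    by rewrite (negPf as_) cal eqxx.
  have cal : c a = l by have := H a; rewrite (negPf as_) ffunE eqxx => /eqP.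
  split; last exact/eqP.
  apply/forallP=> i; have := H i; rewrite inE ffunE.
  by have [->|//] := eqVneq i a; rewrite cal lS.
rewrite (eq_bigr _ inner) big_cons mulrCA.
set P := \prod_(i <- s) _.
have P0 : 0 <= P.
  apply: prodr_ge0 => i _; case: ifP => _; last exact: ler0n.
  exact: le_trans Sx.
have QS : Q \subset S by apply: subsetIr.
have outer : \sum_(l in S) ffact_ratio x #|S| #|if a \in X then l |: Q else Q|
    <= ffact_ratio x #|S| #|Q| * (if a \in X then x else #|S|%:R)
  /\ ((#|X| <= #|S|)%N ->
    \sum_(l in S) ffact_ratio x #|S| #|if a \in X then l |: Q else Q|
    = ffact_ratio x #|S| #|Q| * (if a \in X then x else #|S|%:R)).
  have [aX|aX] := boolP (a \in X); last by rewrite sumr_const mulr_natr.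
  have [le_ eq_] := ffact_ratio_step Sx QS; split=> // XS; apply: eq_.
  apply: leq_trans XS; apply: leq_ltn_trans (_ : #|X'| < _)%N.
    apply: leq_trans (leq_imset_card c0 _).
    by apply: subset_leq_card; exact: subsetIl.
  apply: proper_card; apply/properP; split; first exact: subsetDl.
  by exists a => //; rewrite !inE eqxx.
have IHl l := IH (upd l) us.
split.
  apply: le_trans (_ : \sum_(l in S)
    ffact_ratio x #|S| #|if a \in X then l |: Q else Q| * P <= _).
    by apply: ler_sum => l lS; have [+ _] := IHl l; rewrite updE.
  rewrite -mulr_suml mulrA [X in _ <= X * _]mulrC.
  by apply: ler_wpM2r => //; exact: outer.1.
move=> XS; rewrite mulrA [in RHS](mulrC _ (ffact_ratio _ _ _)).
rewrite -(outer.2 XS) mulr_suml.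
by apply: eq_bigr => l lS; have [_ ->] := IHl l; rewrite ?updE.
Qed.

Lemma sum_all_colourings m X (t0 : T) : #|T|%:R <= m -> (#|X| <= #|T|)%N ->
  \sum_(c : {ffun I -> T}) ffact_ratio m #|T| #|c @: X| =
  \prod_i (if i \in X then m else #|T|%:R).
Proof.
move=> Tm XT; have := @sum_colourings m X [set: T] (enum I) [ffun=> t0].
rewrite cardsT => /(_ Tm (enum_uniq _)) [_ /(_ XT)].
have -> : X :\: [set i in enum I] = set0.
  by apply/setP=> i; rewrite !inE mem_enum.
rewrite imset0 set0I cards0 {2}/ffact_ratio big_ord0 mul1r big_enum /= => <-.
apply: eq_big => [c|c _]; last by rewrite setIT.
by symmetry; apply/forallP=> i; rewrite mem_enum inE.
Qed.

(** The colourings whose class of colour [k] is the complement of [A] are the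
    colourings of [A] with the other #|T| - 1 colours.  Counting [k] as used
    even if its class misses [X] only increases the weight, by
    [ffact_ratio_leS], and by [ffact_ratioSl] it leaves the weight with
    parameters [m - 1] and #|T| - 1, up to the factor [m / #|T|]. *)
Lemma sum_colourings_class m X A (k : T) : #|T|%:R <= m ->
  \sum_(c : {ffun I -> T} | [set i | c i != k] == A)
     ffact_ratio m #|T| #|c @: X| <=
  m / #|T|%:R * \prod_(i in A) ((if i \in X then m else #|T|%:R) - 1).
Proof.
move=> Tm; pose S := [set~ k].
have ST : #|T| = #|S|.+1.
  by rewrite cardsC1 prednK //; apply/card_gt0P; exists k.
have Tm1 : #|S|%:R <= m - 1 by rewrite lerBrDr natr1 -ST.
have m0 : 0 <= m by apply: le_trans Tm.
have := @sum_colourings (m - 1) X S (enum A) [ffun=> k] Tm1 (enum_uniq _).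
move=> [+ _].
have -> : [ffun=> k] @: (X :\: [set i in enum A]) :&: S = set0.
  apply/setP=> l; rewrite !inE; apply/andP=> -[/imsetP[i _ ->]].
  by rewrite ffunE eqxx.
rewrite cards0 {2}/ffact_ratio big_ord0 mul1r big_enum /=.
rewrite (eq_bigr (fun i => (if i \in X then m else #|T|%:R) - 1)); last first.
  by move=> i _; case: ifP => // _; rewrite ST -natr1 addrK.
move=> H; apply: le_trans (ler_wpM2l _ H); last first.
  by apply: divr_ge0.
rewrite mulr_sumr; apply: le_trans (_ : \sum_(c : {ffun I -> T} |
    [set i | c i != k] == A) m / #|T|%:R *
    ffact_ratio (m - 1) #|S| #|c @: X :&: S| <= _).
  apply: ler_sum => c _; rewrite [in m / _]ST -ffact_ratioSl -ST.
  have -> : c @: X :&: S = c @: X :\ k by rewrite /S -setDE.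
  rewrite (cardsD1 k); case: (k \in _) => //=.
  rewrite add0n ffact_ratio_leS // ST ltnS /S.
  by apply: subset_leq_card; apply/subsetP=> l; rewrite !inE => /andP[].
rewrite le_eqVlt; apply/orP; left; apply/eqP/eq_bigl => c.
apply/eqP/forallP => [<- i|H0].
  rewrite mem_enum !inE ffunE.
  by case: (eqVneq (c i) k).
apply/setP=> i; have := H0 i; rewrite mem_enum !inE ffunE.
by case: (i \in A) => // /eqP ->; rewrite eqxx.
Qed.

End Colourings.

(** * Families missing exactly one class complement of every colouring *)

Section ExactlyOne.

Variables (r n : nat) (F : {set {set 'I_n}}).
Hypotheses (r3 : (3 <= r)%N)
  (exact1 : forall c : {ffun 'I_n -> 'I_r},
     #|[set k | [set i | c i != k] \notin F]| = 1%N).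

Let bad (U : {set 'I_n}) := ~: U \notin F.

Lemma unique_bad_class (c : {ffun 'I_n -> 'I_r}) :
  exists k, forall l, bad [set i | c i == l] = (l == k).
Proof.
have /eqP/cards1P[k /setP Hk] := exact1 c; exists k => l.
have := Hk l; rewrite !inE /bad => <-; congr (_ \notin F).
by apply/setP=> i; rewrite !inE.
Qed.

(** Take [U], [V] and the rest as the classes of three of the colours; the other
    classes are empty.  The empty set is not bad since it is the class of at
    least two colours in a constant colouring. *)
Lemma bad_trichotomy (U V : {set 'I_n}) : [disjoint U & V] ->
  [/\ ~~ bad set0, ~~ (bad U && bad V) &
      [|| bad U, bad V | bad (~: (U :|: V))]].
Proof.
move=> dUV.
pose k0 : 'I_r := Ordinal (leq_trans (isT : 0 < 3)%N r3).
pose k1 : 'I_r := Ordinal (leq_trans (isT : 1 < 3)%N r3).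
pose k2 : 'I_r := Ordinal (leq_trans (isT : 2 < 3)%N r3).
have bad0 : ~~ bad set0.
  have [k Hk] := unique_bad_class [ffun=> k0].
  have E l : l != k0 -> [set i : 'I_n | [ffun=> k0] i == l] = set0.
    by move=> lk; apply/setP=> i; rewrite !inE ffunE eq_sym (negPf lk).
  apply/negP=> b0; have := Hk k1; have := Hk k2.
  by rewrite !E // b0 => /esym/eqP <-.
pose c := [ffun i => if i \in U then k0 else if i \in V then k1 else k2].
have c0 : [set i | c i == k0] = U.
  by apply/setP=> i; rewrite !inE ffunE; case: ifP => // _; case: ifP.
have c1 : [set i | c i == k1] = V.
  apply/setP=> i; rewrite !inE ffunE; case: ifP => [iU|_]; last by case: ifP.
  by rewrite (disjointFr dUV iU).
have c2 : [set i | c i == k2] = ~: (U :|: V).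
  by apply/setP=> i; rewrite !inE ffunE; case: ifP => // _; case: ifP.
have cE l : l != k0 -> l != k1 -> l != k2 -> [set i | c i == l] = set0.
  move=> l0 l1 l2; apply/setP=> i; rewrite !inE ffunE eq_sym.
  by case: ifP => _; [|case: ifP => _]; apply: negbTE.
have [k Hk] := unique_bad_class c; split=> //.
  by rewrite -c0 -c1 !Hk; apply/negP=> /andP[/eqP <-].
rewrite -c2 -c0 -c1 !Hk ![_ == k]eq_sym.
apply: contraNT bad0; rewrite !negb_or => /and3P[? ? ?].
by rewrite -(cE k) // Hk.
Qed.

(** By [bad_trichotomy] the bad sets form an ultrafilter on a finite set.
    It is principal: a bad set of minimal size cannot be split into two
    non-empty parts, hence is a singleton. *)
Lemma exactly_one_star : exists x, F = star x.
Proof.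
have dis0 (U : {set 'I_n}) : [disjoint U & set0] by rewrite -setI_eq0 setI0.
have [bad0 _ badT] := bad_trichotomy (dis0 set0).
have {}badT : bad setT by move: badT; rewrite (negPf bad0) /= setU0 setC0.
case: (arg_minnP (fun U : {set 'I_n} => #|U|) badT) => U badU minU.
have /set0Pn[x xU] : U != set0 by apply: contraNneq bad0 => <-.
have badx : bad [set x].
  apply: contraT => nbx.
  have UxU : U :\ x != U.
    by apply: contraTneq xU => <-; rewrite !inE eqxx.
  have nbUx : ~~ bad (U :\ x).
    apply: contraT => /negPn /minU; rewrite (cardsD1 x U) xU add1n.
    by rewrite ltnn.
  have dx : [disjoint [set x] & U :\ x] by rewrite disjoints1 !inE eqxx.
  have [_ _] := bad_trichotomy dx.
  rewrite (negPf nbx) (negPf nbUx) setD1K //= => bCU.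
  have := @bad_trichotomy U (~: U); rewrite badU bCU.
  by case=> //; rewrite -setI_eq0 setICr.
exists x; apply/setP=> A; rewrite inE; apply/idP/idP => [AF|xA].
  apply: contraT => xA.
  have [_ _] := bad_trichotomy (dis0 (~: A)).
  rewrite (negPf bad0) setU0 setCK {1}/bad setCK AF /= => bA.
  have := @bad_trichotomy [set x] A; rewrite badx bA.
  by case=> //; rewrite disjoints1.
apply: contraT => AF.
have := @bad_trichotomy [set x] (~: A); rewrite badx /bad setCK AF.
by case=> //; rewrite disjoints1 inE xA.
Qed.

End ExactlyOne.

(** * The measure with large entries on at most r coordinates *)

Section Core.

Variables (R : realType) (r n : nat) (m : R) (X : {set 'I_n}).
Variable F : {set {set 'I_n}}.
Hypotheses (r0 : (0 < r)%N) (rm : r%:R <= m) (Xr : (#|X| <= r)%N).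
Hypothesis hF : wise_intersecting r F.

(* Under the law proportional to w and given the colours of other elements, i
   receives a given colour in use on X with conditional probability 1 / d i. *)
Let d i : R := if i \in X then m else r%:R.
Let q i : R := 1 - (d i)^-1.
Let w (c : {ffun 'I_n -> 'I_r}) : R := ffact_ratio m r #|c @: X|.
Let bad (c : {ffun 'I_n -> 'I_r}) := [set k | [set i | c i != k] \notin F].

(** The complements of the colour classes have no common element. *)
Lemma bad_gt0 c : (0 < #|bad c|)%N.
Proof.
apply: contraT; rewrite -eqn0Ngt cards_eq0 => /eqP/setP bad0.
have /set0Pn[i /bigcapP iA] : \bigcap_(k < r) [set i | c i != k] != set0.
  by apply: hF => k; have := bad0 k; rewrite !inE => /negPn.
by have := iA (c i) isT; rewrite inE eqxx.
Qed.

Lemma d_gt0 i : 0 < d i.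
Proof.
have : 0 < r%:R :> R by rewrite ltr0n.
by rewrite /d; case: ifP => // _ /lt_le_trans; apply.
Qed.

Lemma weight_d (A : {set 'I_n}) :
  (\prod_(i in A) q i) * (\prod_(j in ~: A) (1 - q j)) =
  (\prod_(i in A) (d i - 1)) / \prod_i d i.
Proof.
rewrite weightE [\prod_(i in A) _]big_mkcond /= -prodf_div.
apply: eq_bigr => i _; have := d_gt0 i; rewrite /q => d0.
by case: ifP => _; field; rewrite gt_eqF.
Qed.

(** Double counting of the pairs of a colouring and a bad colour, grouped by the
    colour and the complement of its class. *)
Lemma sum_bad :
  \sum_c w c * #|bad c|%:R <= m * (\prod_i d i) * biased_measure q (~: F).
Proof.
have -> : \sum_c w c * #|bad c|%:R =
  \sum_(k < r) \sum_(A in ~: F)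
    \sum_(c : {ffun 'I_n -> 'I_r} | [set i | c i != k] == A) w c.
  under eq_bigr => c _ do rewrite -sum1_card natr_sum mulr_sumr.
  rewrite (exchange_big_dep xpredT) //=; apply: eq_bigr => k _.
  rewrite (partition_big (fun c : {ffun 'I_n -> 'I_r} => [set i | c i != k])
    (mem (~: F))) /=; last first.
    by move=> c; rewrite !inE.
  apply: eq_bigr => A; rewrite inE => AF.
  apply: eq_big => [c|c _]; last by rewrite mulr1.
  by rewrite inE; have [->|] := eqVneq; rewrite ?AF ?andbF.
apply: le_trans (_ : \sum_(k < r) \sum_(A in ~: F) m / r%:R *
    \prod_(i in A) (d i - 1) <= _).
  apply: ler_sum => k _; apply: ler_sum => A _.
  by have := @sum_colourings_class R _ 'I_r m X A k; rewrite card_ord; apply.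
rewrite sumr_const card_ord -[_ *+ r]mulr_natl.
rewrite /biased_measure !mulr_sumr; apply: ler_sum => A _.
rewrite weight_d.
have r0' : r%:R != 0 :> R by rewrite pnatr_eq0 -lt0n.
have D0 : \prod_i d i != 0 by apply/prodf_neq0 => i _; rewrite gt_eqF // d_gt0.
by rewrite le_eqVlt; apply/orP; left; apply/eqP; field; apply/andP.
Qed.

Lemma w_gt0 c : 0 < w c.
Proof.
apply: ffact_ratio_gt0 => //.
by apply: leq_trans Xr; apply: leq_imset_card.
Qed.

Lemma sum_w : \sum_c w c = \prod_i d i.
Proof.
have := @sum_all_colourings R _ 'I_r m X (Ordinal r0).
by rewrite card_ord; apply.
Qed.

(** Every colouring has a bad colour, so the total weight [\prod_i d i] of all
    colourings is at most the left side of [sum_bad]. *)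
Lemma core_bound : biased_measure q F <= 1 - m^-1.
Proof.
rewrite measureC lerD2l lerN2.
have m0 : 0 < m by apply: lt_le_trans rm; rewrite ltr0n.
have D0 : 0 < \prod_i d i by apply: prodr_gt0 => i _; apply: d_gt0.
rewrite -[m^-1]mul1r ler_pdivrMr // -(ler_pM2l D0) mulr1 -{1}sum_w.
apply: le_trans (le_trans _ sum_bad) _; last first.
  by rewrite -mulrA mulrCA [m * _]mulrC.
apply: ler_sum => c _; rewrite ler_peMr ?(ltW (w_gt0 _)) //.
by rewrite ler1n bad_gt0.
Qed.

(** Equality in [core_bound] leaves no room for a second bad colour, because
    every colouring has positive weight. *)
Lemma core_eq : biased_measure q F = 1 - m^-1 -> forall c, #|bad c| = 1%N.
Proof.
move=> E.
have m0 : 0 < m by apply: lt_le_trans rm; rewrite ltr0n.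
have {}E : biased_measure q (~: F) = m^-1 by move: E; rewrite measureC; lra.
have := sum_bad; rewrite E mulrAC divff ?gt_eqF // mul1r -sum_w.
rewrite -subr_le0 -sumrB => H.
have ge0 c : 0 <= w c * #|bad c|%:R - w c.
  by rewrite subr_ge0 ler_peMr ?(ltW (w_gt0 _)) // ler1n bad_gt0.
have /eqP : \sum_c (w c * #|bad c|%:R - w c) = 0.
  by apply/le_anti; rewrite H sumr_ge0.
rewrite psumr_eq0 // => /allP H0 c.
have := H0 c (mem_index_enum _).
rewrite -{2}[w c]mulr1 -mulrBr mulf_eq0 gt_eqF ?w_gt0 //= subr_eq0.
by rewrite pnatr_eq1 => /eqP.
Qed.

End Core.

(** * The bound *)

Lemma zext_ord (R : realType) n (p : 'I_n -> R) (i : 'I_n) : zext p i = p i.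
Proof. by rewrite /zext valK. Qed.

(** Compare [p] with the vector that is [P = max(p1, Q)] on the first [r]
    coordinates and [Q] on the others, to which [core_bound] and [core_eq] apply
    with [m = 1 / (1 - P)]. *)
Lemma upset_bound (R : realType) (r n : nat) (p : 'I_n -> R)
    (F : {set {set 'I_n}}) (p1 : R) :
  (3 <= r)%N -> (forall i, 0 < p i < 1) -> (forall i, p i <= p1) ->
  0 < p1 < 1 ->
  (forall i : 'I_n, (r <= i)%N -> p i <= (r%:R - 1) / r%:R) ->
  wise_intersecting r F -> upset F ->
  biased_measure p F <= p1 /\
  (biased_measure p F = p1 -> exists x, F = star x).
Proof.
move=> r3 p01 pp1 /andP[p1_gt0 p1_lt1] ptail hF upF.
have r0 : (0 < r)%N by apply: leq_trans r3.
have rR : 1 < r%:R :> R by rewrite ltr1n; apply: leq_trans r3.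
have r0R : 0 < r%:R :> R by lra.
set Q : R := (r%:R - 1) / r%:R in ptail *.
have QE : Q = 1 - r%:R^-1 by rewrite /Q; field; rewrite gt_eqF.
have ri : 0 < r%:R^-1 :> R by rewrite invr_gt0.
have Q0 : 0 < Q by apply: divr_gt0; lra.
have Q1 : Q < 1 by lra.
pose P := Num.max p1 Q.
have P0 : 0 < P by rewrite lt_max p1_gt0.
have P1 : P < 1 by rewrite gt_max p1_lt1.
have QP : Q <= P by rewrite le_max lexx orbT.
have p1P : p1 <= P by rewrite le_max lexx.
have lnP : ln P < 0 by rewrite -ln1 ltr_ln ?posrE.
pose t := ln p1 / ln P.
have t1 : 1 <= t.
  rewrite -(divff (_ : ln P != 0)) ?lt_eqF // ler_ndivlMr //.
  by rewrite divfK ?lt_eqF // ler_ln.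
have Pt : powR P t = p1.
  by rewrite /powR gt_eqF // divfK ?lt_eqF // lnK.
(* Either P = Q, and the right side is p1, or P = p1, and t = 1. *)
have Qt (x : R) : x <= p1 -> x <= Q -> x <= powR Q t.
  move=> xp xQ; have [p1Q|Qp1] := leP p1 Q.
    by have <- : P = Q; [exact: max_r | rewrite Pt].
  have PE : P = p1 by apply: max_l; exact: ltW.
  by rewrite /t PE divff ?powRr1 // ?ltW // -PE lt_eqF.
pose m := (1 - P)^-1.
have rm : r%:R <= m.
  by rewrite -[r%:R]invrK lef_pV2 ?posrE //; lra.
pose X : {set 'I_n} := [set i : 'I_n | (i < r)%N].
have Xr : (#|X| <= r)%N.
  pose f (i : 'I_n) : 'I_r := insubd (Ordinal r0) (i : nat).
  have injf : {in X &, injective f}.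
    move=> i j; rewrite !inE => ir jr /(congr1 val).
    by rewrite !val_insubd ir jr => /val_inj.
  by have := max_card (f @: X); rewrite (card_in_imset injf) card_ord.
pose q (i : 'I_n) : R := 1 - (if i \in X then m else r%:R)^-1.
have qE i : q i = if i \in X then P else Q.
  by rewrite /q QE; case: ifP => // _; rewrite invrK; lra.
have q01 i : 0 <= q i <= 1.
  by rewrite qE; case: ifP => _; apply/andP; split; exact: ltW.
have p01' i : 0 <= p i <= 1.
  by have /andP[? ?] := p01 i; apply/andP; split; exact: ltW.
have pq i : p i <= powR (q i) t.
  rewrite qE inE ltnNge; have [ri'|_] /= := leqP r i; first exact/Qt/ptail.
  by rewrite Pt.
have mE : 1 - m^-1 = P by rewrite invrK; lra.
have pow_le : biased_measure p F <= powR (biased_measure q F) t.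
  by rewrite !biased_measureE; apply: expose_powR.
have q0 : 0 <= biased_measure q F by rewrite biased_measureE expose_ge0.
have qP : biased_measure q F <= P by rewrite -mE; apply: core_bound.
have t0 : 0 < t by lra.
have pow_P : powR (biased_measure q F) t <= p1.
  by rewrite -Pt; apply: ge0_ler_powR; rewrite ?nnegrE // ltW.
split=> [|E]; first exact: le_trans pow_P.
apply: (@exactly_one_star r) => //; apply: (@core_eq R r n m X) => //.
rewrite mE; apply: (powR_injective t0); rewrite ?nnegrE ?(ltW P0) //.
by rewrite Pt; apply/le_anti; rewrite pow_P -E pow_le.
Qed.

Theorem theorem1p2 (R : realType) (r n : nat) (p : 'I_n -> R)
    (F : {set {set 'I_n}})
    (hr : (3 <= r)%N) (hn : (1 <= n)%N)
    (hp01 : forall i : 'I_n, 0 < p i < 1)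
    (hpmono : forall i j : 'I_n, (i <= j)%N -> p j <= p i)
    (hpr : zext p r < (r%:R - 1) / r%:R)
    (hF : wise_intersecting r F) :
  biased_measure p F <= zext p 0 /\
  (biased_measure p F = zext p 0 <->
   exists i : 'I_n, p i = zext p 0 /\ F = star i).
Proof.
have z0 : zext p 0 = p (Ordinal hn) := zext_ord p (Ordinal hn).
rewrite z0.
have ptail (i : 'I_n) : (r <= i)%N -> p i <= (r%:R - 1) / r%:R.
  move=> ri; have rn := leq_ltn_trans ri (ltn_ord i).
  apply: le_trans (hpmono (Ordinal rn) i ri) _.
  by rewrite -zext_ord /= ltW.
have [le_ eq_] := upset_bound hr hp01 (fun i => hpmono (Ordinal hn) i isT)
  (hp01 _) ptail (up_closure_wise hF) (@up_closureP _ F).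
have [leF eqF] := measure_sub hp01 (sub_up_closure F).
split; first exact: le_trans leF le_.
split=> [E|[i [<- ->]]]; last exact: measure_star.
have E' : biased_measure p (up_closure F) = p (Ordinal hn).
  by apply/le_anti; rewrite le_ -E leF.
have [x Fx] := eq_ E'.
have FE : F = up_closure F by apply/eqP; rewrite -eqF E E'.
by exists x; rewrite -E FE Fx measure_star.
Qed.
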